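(* There is $n_0$ such that for all $n\ge n_0$ there exists an integer $b$ with $200\, n\ln n \leq b \leq 201\, n\ln n$ such that in the strict $(1:b)$ Avoider-Enforcer game on $E(K_n)$ Avoider has a strategy ensuring that at the end of the game Avoider's graph is a forest.
   Context: Avoider-Enforcer games on $E(K_n)$: two players, Avoider (who moves first) and Enforcer, alternately claim previously unclaimed edges of the complete graph $K_n$ until all edges are claimed; Avoider's graph is the graph on $V(K_n)$ formed by the edges he claimed. In the strict $(1:b)$ game, in each turn Avoider claims exactly $1$ unclaimed edge and Enforcer claims exactly $b$ unclaimed edges; if fewer than $b$ unclaimed edges remain at Enforcer's turn, he claims all of them. $\ln$ denotes the natural logarithm. *)

(* Defs.v *)
From mathcomp Require Import all_boot.

Set Implicit Arguments.
Unset Strict Implicit.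
Unset Printing Implicit Defensive.

(* An edge is the set of its two endpoints. *)
Definition complete_edges (n : nat) : {set {set 'I_n}} :=
  [set e : {set 'I_n} | #|e| == 2].

Definition adj (n : nat) (A : {set {set 'I_n}}) : rel 'I_n :=
  fun u v => (u != v) && ([set u; v] \in A).

(* [ucycle] also accepts [:: u; v] for an edge uv; cycles of a simple graph
   have at least three vertices. *)
Definition is_forest (n : nat) (A : {set {set 'I_n}}) : Prop :=
  forall c : seq 'I_n, 2 < size c -> ~ ucycle (adj A) c.

(* The edge claimed by Avoider, then the set of edges claimed by Enforcer in
   reply. *)
Definition round (n : nat) : Type := ({set 'I_n} * {set {set 'I_n}})%type.

(* Most recent round first. *)
Definition history (n : nat) : Type := seq (round n).

Fixpoint avoider_edges (n : nat) (h : history n) : {set {set 'I_n}} :=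
  if h is r :: h' then r.1 |: avoider_edges h' else set0.

Fixpoint enforcer_edges (n : nat) (h : history n) : {set {set 'I_n}} :=
  if h is r :: h' then r.2 :|: enforcer_edges h' else set0.

Definition unclaimed (n : nat) (h : history n) : {set {set 'I_n}} :=
  complete_edges n :\: (avoider_edges h :|: enforcer_edges h).

(* The minimum covers Enforcer's last turn, including the case where Avoider
   took the last edge and Enforcer claims nothing. *)
Fixpoint legal (n b : nat) (h : history n) : Prop :=
  if h is r :: h' then
    let rest := unclaimed h' :\ r.1 in
    [/\ legal b h', r.1 \in unclaimed h', r.2 \subset rest
      & #|r.2| = minn b #|rest|]
  else True.

Definition strategy (n : nat) : Type := history n -> {set 'I_n}.

Fixpoint follows (n : nat) (s : strategy n) (h : history n) : Prop :=
  if h is r :: h' then r.1 = s h' /\ follows s h' else True.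

Definition legal_strategy (n b : nat) (s : strategy n) : Prop :=
  forall h : history n, legal b h -> follows s h ->
    unclaimed h != set0 -> s h \in unclaimed h.

Definition avoider_can_force (n b : nat) (P : {set {set 'I_n}} -> Prop) : Prop :=
  exists s : strategy n, legal_strategy b s /\
    forall h : history n, legal b h -> follows s h ->
      unclaimed h = set0 -> P (avoider_edges h).

(* Main.v *)
(** Let s_x be the size of the component of x in Avoider's graph.  Avoider always
    takes a free edge xy joining two components and minimizing s_x s_y.  The
    number P of ordered connected pairs, P = sum_x s_x, starts at n and grows by
    at most 2 s_x s_y.  With F free edges, at least F - P ordered pairs are
    eligible and sum_{x,y} s_x s_y = P^2, so the increment is at most
    2 P^2 / (F - P), which is O(n^2 / F) as long as P <= 2n <= F / 2.  Before the
    i-th round from the end F is at least about i b / 2, so the total growth is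
    O((n^2 / b) ln n), and b >= 200 n ln n keeps P <= 2n.  For the last round
    this needs the remainder of the number of edges modulo b + 1 to be large,
    which is arranged by taking b = floor(C(n,2) / k) for a suitable k. *)

Require Import Defs.
From mathcomp Require Import all_boot all_order all_algebra.
From mathcomp Require Import reals sequences exp.
From mathcomp Require Import zify ring lra.
Import Order.TTheory GRing.Theory Num.Theory.

Set Implicit Arguments.
Unset Strict Implicit.

(** * Forests under addition of an edge between two components *)

Lemma adj_sym n (A : {set {set 'I_n}}) : symmetric (adj A).
Proof. by move=> x y; rewrite /adj eq_sym setUC. Qed.

Lemma connect_adjC n (A : {set {set 'I_n}}) : connect_sym (adj A).
Proof. exact/sym_connect_sym/adj_sym. Qed.

Lemma set2_eqP (T : finType) (x y u v : T) :
  [set x; y] = [set u; v] -> (x = u /\ y = v) \/ (x = v /\ y = u).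
Proof.
move=> E.
have : x \in [set u; v] by rewrite -E set21.
have : y \in [set u; v] by rewrite -E set22.
have : u \in [set x; y] by rewrite E set21.
have : v \in [set x; y] by rewrite E set22.
rewrite !in_set2 => /orP[] /eqP ? /orP[] /eqP ? /orP[] /eqP ? /orP[] /eqP ?;
  subst; by [left|right].
Qed.

Lemma adj_setU1 n (A : {set {set 'I_n}}) u v x y :
  adj ([set u; v] |: A) x y -> adj A x y \/ (x = u /\ y = v) \/ (x = v /\ y = u).
Proof.
rewrite /adj in_setU1 => /andP[-> /orP[/eqP/set2_eqP|->]]; by [right|left].
Qed.

Lemma is_forest0 n : is_forest (set0 : {set {set 'I_n}}).
Proof. by move=> [|x [|y c]] // _ /andP[/=]; rewrite /adj in_set0 andbF. Qed.

(** A cycle through the new edge, with that edge removed, is a path of [A] between [u] and [v]; a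
    cycle avoiding it lies in [A]. *)
Lemma is_forestU1 n (A : {set {set 'I_n}}) u v :
  is_forest A -> ~~ connect (adj A) u v -> is_forest ([set u; v] |: A).
Proof.
move=> forA nuv c c_gt2 /andP[cyc_c uniq_c].
have [/allP cA|/allPn[x xc nx]] := boolP (all (fun x => adj A x (next c x)) c).
  by apply: (forA c c_gt2); rewrite /ucycle uniq_c andbT cycle_from_next.
have := next_cycle cyc_c xc.
case: (rot_to xc) => i s rot_c.
rewrite -(next_rot i uniq_c) rot_c in nx *.
move: c_gt2 uniq_c cyc_c; rewrite -(size_rot i) -(rot_uniq i) -(rot_cycle i) rot_c.
case: s {rot_c} nx => [|y [|z p]] //=; rewrite eqxx => nxy _.
rewrite !inE !negb_or => /and3P[/and3P[xy xz xp] /andP[yz yp] _] /and3P[_ yz' zp].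
case/adj_setU1=> [/(negP nxy)//|xyE].
(* [y] is an end of the new edge and occurs only once in the cycle, so all steps from [z] onwards to
   [x] are old. *)
have edge a w : adj ([set u; v] |: A) a w -> a != y -> w != y -> adj A a w.
  case/adj_setU1=> // -[[-> ->]|[-> ->]]; case: xyE => -[_ ->]; by rewrite eqxx.
have : connect (adj A) y x.
  apply: (connect_trans (y := z)).
    apply: connect1; case: (adj_setU1 yz') => // E.
    by case: xyE E yz xz => -[-> ->] [] [? ->]; rewrite eqxx.
  apply/connectP; exists (rcons p x); last by rewrite last_rcons.
  apply: (sub_in_path (P := predC1 y)) zp => [a w ay wy /edge|]; first exact.
  rewrite /= [z == y]eq_sym yz all_rcons /= xy; apply/allP => w wp /=.
  by apply: contraNneq yp => <-.
by case: xyE => -[-> ->]; rewrite ?(negPf nuv) // connect_adjC (negPf nuv).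
Qed.

(** * Growth of the number of connected pairs *)

Definition comp_size {n} (A : {set {set 'I_n}}) (x : 'I_n) : nat :=
  #|connect (adj A) x|.

Lemma comp_sizeE n (A : {set {set 'I_n}}) x :
  comp_size A x = \sum_y connect (adj A) x y.
Proof.
rewrite /comp_size -sum1_card big_mkcond; apply: eq_bigr => y _.
by rewrite -[y \in _]/(connect (adj A) x y); case: connect.
Qed.

Definition connected_pairs {n} (A : {set {set 'I_n}}) : nat :=
  \sum_(x : 'I_n) comp_size A x.

Lemma connected_pairs0 n : connected_pairs (set0 : {set {set 'I_n}}) = n.
Proof.
rewrite -[RHS]card_ord -sum1_card; apply: eq_bigr => x _.
apply: (@eq_card1 _ x) => y; apply/idP/eqP => [/connectP[[|z p] //=]|->].
- by rewrite {1}/adj in_set0 andbF.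
- exact: connect0.
Qed.

Lemma connect_setU1 n (A : {set {set 'I_n}}) u v x y :
  connect (adj ([set u; v] |: A)) x y ->
  [|| connect (adj A) x y, connect (adj A) x u && connect (adj A) v y
    | connect (adj A) x v && connect (adj A) u y].
Proof.
case/connectP=> p; elim/last_ind: p y => [|p z IH] y.
  by move=> _ ->; rewrite connect0.
rewrite rcons_path last_rcons => /andP[/IH /(_ erefl) {}IH /adj_setU1 step] ->.
case: step => [e|[[E ->]|[E ->]]].
- case/or3P: IH => [c|/andP[-> c]|/andP[-> c]].
  + by rewrite (connect_trans c (connect1 e)).
  + by rewrite (connect_trans c (connect1 e)) /= orbT.
  + by rewrite (connect_trans c (connect1 e)) /= !orbT.
- rewrite E in IH; case/or3P: IH => [->|/andP[-> c]|/andP[-> c]];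
    by rewrite connect0 /= ?orbT.
- rewrite E in IH; case/or3P: IH => [->|/andP[-> c]|/andP[-> c]];
    by rewrite connect0 /= ?orbT.
Qed.

(** A newly connected ordered pair has one end in the old component of [u] and the other in that of
    [v], in either order. *)
Lemma connected_pairsU1 n (A : {set {set 'I_n}}) u v :
  connected_pairs ([set u; v] |: A)
    <= connected_pairs A + 2 * (comp_size A u * comp_size A v).
Proof.
pose c x w : nat := connect (adj A) x w.
have sum_c w : \sum_x c x w = comp_size A w.
  by rewrite comp_sizeE; apply: eq_bigr => x _; rewrite /c connect_adjC.
have -> : connected_pairs A + 2 * (comp_size A u * comp_size A v)
  = \sum_x (comp_size A x + (c x u * comp_size A v + c x v * comp_size A u)).
  by rewrite !big_split /= -!big_distrl /= !sum_c mul2n -addnn [X in _ + (_ + X)]mulnC.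
rewrite /connected_pairs; apply: leq_sum => x _; rewrite !comp_sizeE.
rewrite !big_distrr /= -!big_split /=; apply: leq_sum => y _.
rewrite /c; case: connect (@connect_setU1 _ A u v x y) => // /(_ isT).
by case: (connect _ x y) (connect _ x u) (connect _ x v) (connect _ u y) (connect _ v y)
  => [] [] [] [] [].
Qed.

(** * Cheapest free edges between components *)

(* Ordered pairs, so a free edge between two components is counted twice. *)
Definition joining_pairs {n} (U A : {set {set 'I_n}}) : {set 'I_n * 'I_n} :=
  [set p | ([set p.1; p.2] \in U) && ~~ connect (adj A) p.1 p.2].

(** Every free edge is the image of an ordered pair of its ends, and this pair is either joining or
    connected. *)
Lemma card_le_joining_pairs n (U A : {set {set 'I_n}}) :
  U \subset complete_edges n -> #|U| <= #|joining_pairs U A| + connected_pairs A.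
Proof.
move=> /subsetP UE.
pose C := [set p : 'I_n * 'I_n | connect (adj A) p.1 p.2].
have -> : connected_pairs A = #|C|.
  rewrite -sum1_card [RHS]big_mkcond (eq_bigr (fun p : 'I_n * 'I_n =>
    (fun x y => (connect (adj A) x y : nat)) p.1 p.2)); last first.
    by move=> p _; rewrite inE; case: connect.
  rewrite -(pair_bigA _ (fun x y => (connect (adj A) x y : nat))) /=.
  by apply: eq_bigr => x _; exact: comp_sizeE.
apply: leq_trans (leq_card_setU _ _).1.
apply: leq_trans (leq_imset_card (fun p => [set p.1; p.2]) _).
apply/subset_leq_card/subsetP => e eU.
have := UE e eU; rewrite inE => /cards2P[x [y [_ E]]].
apply/imsetP; exists (x, y) => //; rewrite !inE /= -E eU /=.
by case: connect.
Qed.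

(** The square expands into the products of component sizes over all ordered pairs, of which only
    the joining ones are kept. *)
Lemma sum_joining_pairs n (U A : {set {set 'I_n}}) m :
  (forall p, p \in joining_pairs U A -> m <= comp_size A p.1 * comp_size A p.2) ->
  m * #|joining_pairs U A| <= connected_pairs A ^ 2.
Proof.
move=> Hm; rewrite -mulnn /connected_pairs big_distrlr /=.
rewrite (pair_bigA _ (fun x y => comp_size A x * comp_size A y)) /=.
rewrite mulnC -sum_nat_const [leqRHS](bigID (mem (joining_pairs U A))) /=.
exact: leq_trans (leq_sum _ Hm) (leq_addr _ _).
Qed.

(** The last branch keeps the move legal when no free edge joins two components; [set0] arises only
    for empty [U]. *)
Definition min_join {n} (U A : {set {set 'I_n}}) : {set 'I_n} :=
  if [pick p in joining_pairs U A] is Some p0 then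
    let p := [arg min_(q < p0 in joining_pairs U A) comp_size A q.1 * comp_size A q.2]
    in [set p.1; p.2]
  else odflt set0 [pick e in U].

Lemma min_join_in n (U A : {set {set 'I_n}}) : U != set0 -> min_join U A \in U.
Proof.
rewrite /min_join => /set0Pn[e eU].
case: pickP => [p0 p0J|_]; first by case: arg_minnP => //= p; rewrite inE => /andP[].
by case: pickP => [//|/(_ e)]; rewrite eU.
Qed.

Lemma min_joinP n (U A : {set {set 'I_n}}) :
  U \subset complete_edges n -> connected_pairs A < #|U| ->
  exists u v, [/\ min_join U A = [set u; v], ~~ connect (adj A) u v
    & comp_size A u * comp_size A v * (#|U| - connected_pairs A) <= connected_pairs A ^ 2].
Proof.
move=> UE ltU; have leJ := card_le_joining_pairs A UE; rewrite /min_join.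
case: pickP => [p0 p0J|J0]; last by move: leJ; rewrite (eq_card0 J0); lia.
case: arg_minnP => //= -[u v] uvJ Hm; exists u, v; split=> //.
  by move: uvJ; rewrite inE => /andP[].
by apply: leq_trans (sum_joining_pairs Hm); rewrite leq_mul2l leq_subLR addnC leJ orbT.
Qed.

(** * The course of the game *)

(** A round uses [b.+1] edges unless fewer are left; it then uses them all, as truncated subtraction
    records. *)
Lemma legal_card_unclaimed n b (h : history n) :
  legal b h -> #|unclaimed h| = 'C(n, 2) - size h * b.+1.
Proof.
elim: h => [_|r h IH /= [/IH {}IH r1 r2 c2]].
  by rewrite /unclaimed /= setU0 setD0 subn0 card_draws card_ord.
have -> : unclaimed (r :: h) = (unclaimed h :\ r.1) :\: r.2.
  by apply/setP => e; rewrite /unclaimed /= !inE !negb_or;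
  do !case: (_ \in _); case: (_ == _).
rewrite cardsD (setIidPr r2) c2; have := cardsD1 r.1 (unclaimed h); rewrite r1 IH.
by move: #|_| => m; rewrite mulSn; lia.
Qed.

Definition balanced_strategy {n} : strategy n :=
  fun h => min_join (unclaimed h) (avoider_edges h).

Local Open Scope ring_scope.

Definition harmonic (R : realFieldType) (m : nat) : R := \sum_(i < m) i.+1%:R^-1.

Lemma harmonic_ge0 (R : realFieldType) m : 0 <= harmonic R m.
Proof. by apply: sumr_ge0 => i _; rewrite invr_ge0. Qed.

Lemma harmonicS (R : realFieldType) m :
  harmonic R m.+1 = harmonic R m + m.+1%:R^-1.
Proof. exact: big_ord_recr. Qed.

(* The invariant says that round [t], counted from 0, adds at most [c / (k - t)]
   to [connected_pairs]. *)
Lemma balanced_invariant (R : realFieldType) (n b k : nat) (c : R) :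
  ('C(n, 2) <= k * b.+1)%N ->
  (forall t, (t < k)%N -> ((k - t) * b.+1 <= 2 * ('C(n, 2) - t * b.+1))%N) ->
  (8 * n <= b.+1)%N ->
  32 * n%:R ^+ 2 <= c * b.+1%:R -> c * harmonic R k <= n%:R ->
  forall h : history n, legal b h -> follows balanced_strategy h ->
  is_forest (avoider_edges h) /\
  (connected_pairs (avoider_edges h))%:R + c * harmonic R (k - size h)
    <= n%:R + c * harmonic R k.
Proof.
move=> round_bound free_bound b_large c_bound harmonic_bound h.
have c_ge0 : 0 <= c.
  rewrite -(pmulr_lge0 _ (ltr0Sn R b)); apply: le_trans c_bound.
  by rewrite mulr_ge0 ?exprn_ge0.
elim: h => [|r h IH] /=.
  by move=> _ _; split; [exact: is_forest0|rewrite connected_pairs0 subn0].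
move=> [leg r1 _ _] [-> fol]; have [forA inv] := IH leg fol.
set A := avoider_edges h in forA inv *; set F := #|unclaimed h|.
have F_E : F = ('C(n, 2) - size h * b.+1)%N := legal_card_unclaimed leg.
have F_gt0 : (0 < F)%N by apply/card_gt0P; exists r.1.
have t_lt : (size h < k)%N.
  rewrite -(ltn_pmul2r (ltn0Sn b)); apply: leq_trans round_bound.
  by rewrite -subn_gt0 -F_E.
have Fb := free_bound _ t_lt; rewrite -F_E in Fb.
have P_le : (connected_pairs A <= 2 * n)%N.
  have cH := mulr_ge0 c_ge0 (harmonic_ge0 R (k - size h)%N).
  rewrite -(ler_nat R) natrM; lra.
(* With [8 * n <= b.+1] this gives [4 * n <= F], so the connected pairs number at most [F / 2]. *)
have F_ge : (b.+1 <= 2 * F)%N.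
  by apply: leq_trans Fb; rewrite leq_pmull // subn_gt0.
have [||u [v [E nuv mF]]] := @min_joinP n (unclaimed h) A.
- exact: subsetDl.
- by rewrite -/A -/F; lia.
rewrite /balanced_strategy -/A E; split; first exact: is_forestU1.
rewrite -/A -/F in mF.
set m := (comp_size A u * _)%N in mF.
have mF2 : (m * F <= 8 * n ^ 2)%N.
  have FP : (F <= 2 * (F - connected_pairs A))%N by lia.
  apply: leq_trans (leq_mul (leqnn m) FP) _; rewrite mulnCA.
  rewrite -[(8 * _)%N]/(2 * 4 * _)%N -mulnA leq_mul2l /=; apply: leq_trans mF _.
  by rewrite -[4%N]/(2 ^ 2)%N -expnMn leq_sqr.
(* The constant 32: [(k - size h) * b.+1 <= 2 * F], hence the product is at most [4 * (m * F)]. *)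
have mk : (2 * m * ((k - size h) * b.+1) <= 32 * n ^ 2)%N.
  apply: leq_trans (leq_mul (leqnn _) Fb) _; nia.
have P' := connected_pairsU1 A u v; rewrite -/m in P'.
have kE : (k - size h = (k - (size h).+1).+1)%N by lia.
rewrite kE in inv mk; move: inv; rewrite harmonicS mulrDr.
set j := (k - (size h).+1)%N in mk *.
have : (2 * m)%:R <= c * j.+1%:R^-1.
  rewrite ler_pdivlMr ?ltr0Sn // -(ler_pM2r (ltr0Sn R b)).
  rewrite -mulrA -!natrM; apply: le_trans c_bound.
  by rewrite -natrX -natrM ler_nat.
move=> step; apply: le_trans; rewrite [X in _ <= _ + X]addrC addrA lerD2r.
by rewrite -(ler_nat R) natrD in P'; apply: le_trans P' _; rewrite lerD2l.
Qed.

Lemma balanced_strategy_forest (R : realFieldType) (n b k : nat) (c : R) :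
  ('C(n, 2) <= k * b.+1)%N ->
  (forall t, (t < k)%N -> ((k - t) * b.+1 <= 2 * ('C(n, 2) - t * b.+1))%N) ->
  (8 * n <= b.+1)%N ->
  32 * n%:R ^+ 2 <= c * b.+1%:R -> c * harmonic R k <= n%:R ->
  avoider_can_force b (@is_forest n).
Proof.
move=> H1 H2 H3 H4 H5; exists balanced_strategy; split=> h leg fol.
  exact: min_join_in.
by move=> _; have [] := balanced_invariant H1 H2 H3 H4 H5 leg fol.
Qed.

(** * Numerical estimates and the choice of the bias *)

Lemma harmonic_le_ln (R : realType) m :
  (0 < m)%N -> harmonic R m <= 1 + ln m%:R.
Proof.
elim: m => [//|[_ _|m /(_ isT) IH _]].
  by rewrite harmonicS /harmonic big_ord0 ln1 invr1; lra.
rewrite harmonicS; set p : R := m.+1%:R in IH *; set q : R := m.+2%:R.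
have p_gt0 : 0 < p by rewrite ltr0Sn.
have q_gt0 : 0 < q by rewrite ltr0Sn.
have pE : p = q - 1 by rewrite /q -[m.+2%:R]natr1 addrK.
have qE : p / q = 1 + - q^-1.
  by rewrite pE mulrBl divff ?gt_eqF // mul1r.
(* The induction step is [ln (1 - 1 / q) <= - 1 / q], where [1 - 1 / q = p / q]. *)
have : -1 < - q^-1.
  by rewrite ltrN2 invf_lt1 // ltr1n.
move/le_ln1Dx; rewrite -qE ln_div ?posrE // => h; clearbody p q; lra.
Qed.

(** Here [l] plays [ln n]. Rounding [N / y] down to [k], with [y] about [200 n l], and then [N / k]
    down to [b] makes [k * b] miss [N] by less than [k]. *)
Lemma round_count (R : realType) (n : nat) (l : R) :
  300 * 1000 <= l -> l ^+ 2 / 2 <= n%:R ->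
  exists k b : nat, [/\ (300 <= k <= n)%N, (k * b <= 'C(n, 2) <= k * b.+1)%N,
    200 * n%:R * l <= b%:R & b%:R <= 201 * n%:R * l].
Proof.
move=> l_ge nl.
have binE : 2 * 'C(n, 2)%:R = n%:R * (n%:R - 1) :> R.
  have n_gt0 : (0 < n)%N by rewrite -(ltr0n R); nra.
  rewrite -natrM -(mul_bin_diag n 1) bin1 natrM -subn1 natrB //.
move: 'C(n, 2) binE => N NE.
have [x xE] : exists x : R, n%:R = x by exists n%:R.
rewrite xE in nl NE *.
have xl : 150 * 1000 * l <= x by nra.
have xx : 0 <= x * (x - 150 * 1000 * l) by rewrite mulr_ge0; lra.
have lx : 0 <= x * (l - 300 * 1000) by rewrite mulr_ge0; lra.
(* The extra 1 pays for rounding [b] down: [y < b + 1] gives [200 * x * l < b]. *)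
have [y yE] : exists y : R, 200 * x * l + 1 = y by exists (200 * x * l + 1).
have y_gt0 : 0 < y by lra.
have yN : 300 * y <= N%:R by lra.
have [x_ge0 yx xl_ge] : [/\ 0 <= x, x <= y & 403 <= x * l] by split; lra.
clear l_ge nl xl xx lx.
have Ny_ge0 : 0 <= N%:R / y by rewrite divr_ge0 // ltW.
have /andP[] := truncn_itv Ny_ge0.
have : (300 <= Num.truncn (N%:R / y))%N by rewrite truncn_ge_nat // ler_pdivlMr.
move: (Num.truncn _) => k k_ge; rewrite ler_pdivlMr // ltr_pdivrMr // => kyN Nky.
have k_geR : 300 <= k%:R :> R by rewrite (ler_nat R 300).
have Nkb := ltn_ceil N (leq_trans (isT : 0 < 300)%N k_ge).
have kb := leq_divM N k; move: (N %/ k)%N Nkb kb => b Nkb kb.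
have kbR : b%:R * k%:R <= N%:R :> R by rewrite -natrM ler_nat.
have NkbR : N%:R < (b%:R + 1) * k%:R :> R by rewrite natr1 -natrM ltr_nat.
rewrite -natr1 in Nky.
exists k, b; split.
- rewrite k_ge /= -(ler_nat R) xE leNgt; apply/negP => xk.
  have : 0 <= k%:R * (y - x) by rewrite mulr_ge0 //; lra.
  have : 0 <= x * (k%:R - x) by rewrite mulr_ge0; lra.
  lra.
- by rewrite mulnC kb mulnC ltnW.
- have : k%:R * y < (b%:R + 1) * k%:R by lra.
  by rewrite mulrC ltr_pM2r; lra.
(* From [b k <= N < (k + 1) y] follows [b < (1 + 1 / k) y], and [k >= 300] keeps this below
   [201 x l]. *)
- rewrite leNgt -yE in Nky *; apply/negP => h.
  have : 0 <= (b%:R - 201 * x * l) * k%:R by rewrite mulr_ge0; lra.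
  have : 0 <= (x * l - 2) * (k%:R - 201) by rewrite mulr_ge0; lra.
  lra.
Qed.

(** * Instantiation of the constants for large [n] *)

Theorem theorem1p2 (R : realType) :
  exists n0 : nat, forall n : nat, (n0 <= n)%N ->
    exists b : nat,
      [/\ 200 * n%:R * ln n%:R <= b%:R :> R,
          b%:R <= 201 * n%:R * ln n%:R :> R
        & avoider_can_force b (@is_forest n)].
Proof.
exists (Num.truncn (expR (300 * 1000 : R))).+1 => n n_ge.
have n_expR : expR (300 * 1000 : R) <= n%:R.
  by apply: (le_trans (ltW (truncnS_gt _))); rewrite ler_nat.
have n_gt0 : 0 < n%:R :> R by apply: lt_le_trans n_expR; exact: expR_gt0.
have nE : expR (ln n%:R) = n%:R :> R by rewrite lnK.
set l : R := ln n%:R in nE *.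
have l_ge : 300 * 1000 <= l by rewrite -[leLHS]expRK ler_ln ?posrE ?expR_gt0.
have l_ge0 : 0 <= l by lra.
have n_sq : l ^+ 2 / 2 <= n%:R.
  by have := expR_ge1Dxn 1 l_ge0; rewrite nE (_ : 2`!%:R = 2) //; lra.
have [k [b [/andP[k_ge k_le] /andP[kb_le kb_ge] b_ge b_le]]] := round_count l_ge n_sq.
exists b; split=> //.
have b_large : (200 * n <= b)%N.
  rewrite -(ler_nat R) natrM; apply: le_trans b_ge.
  by rewrite ler_peMr; lra.
(* This [c] satisfies [c * (200 n l) = 32 n^2], while [c * harmonic R k <= c * 2 l = 64 n / 200]. *)
have c_ge0 : 0 <= 32 * n%:R / (200 * l) by rewrite divr_ge0; lra.
apply: (@balanced_strategy_forest R n b k (32 * n%:R / (200 * l))) => //.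
- move=> t tk.
  (* The bracket is [(k - t) * b.+1 - k], and [2 * k <= b.+1] since [k <= n] and [200 * n <= b]; so
     even the last round starts with enough free edges. *)
  suff : ((k - t) * b.+1 <= 2 * (k * b - t * b.+1))%N.
    by move/leq_trans; apply; rewrite leq_mul2l leq_sub2r.
  by clear -tk k_ge k_le b_large; nia.
- by clear -b_large; lia.
- apply: (@le_trans _ _ (32 * n%:R / (200 * l) * (200 * n%:R * l))).
    by rewrite le_eqVlt; apply/orP; left; apply/eqP; field; rewrite gt_eqF //; lra.
  by apply: ler_wpM2l => //; apply: le_trans b_ge _; rewrite ler_nat.
- have k_gt0 : (0 < k)%N by apply: leq_trans k_ge.
  have harm : harmonic R k <= 2 * l.
    have := harmonic_le_ln R k_gt0.
    have : ln k%:R <= l by rewrite ler_ln ?ler_nat // posrE ltr0n.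
    lra.
  apply: le_trans (ler_wpM2l c_ge0 harm) _.
  rewrite [leLHS](_ : _ = 64 / 200 * n%:R); first lra.
  by field; rewrite gt_eqF //; lra.
Qed.
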